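(* Let $(E,\pi)$ be a Jordan Banach triple system. If $(E,\pi)$ is Aron--Berner regular, then $(E^{**},\pi^i)$ is a Jordan Banach triple system for each $i\in\{0,1,\ldots,5\}$.
   Context: Jordan Banach triple systems are taken complex: a complex Banach space $E$ with a jointly continuous map $\pi=\{\cdot,\cdot,\cdot\}:E\times E\times E\to E$ which is bilinear and symmetric in the outer variables, conjugate linear in the middle one, and satisfies the Jordan identity $\{a,b,\{c,d,e\}\}=\{\{a,b,c\},d,e\}-\{c,\{b,a,d\},e\}+\{c,d,\{a,b,e\}\}$ for all $a,b,c,d,e\in E$. The six Aron--Berner extensions $\pi^0,\dots,\pi^5:E^{**}\times E^{**}\times E^{**}\to E^{**}$ of $\pi$ (bilinear in the outer variables, conjugate linear in the middle one) are given by iterated $w^*$-limits: for $m,n,p\in E^{**}$ and bounded nets $(m_{\alpha_1}),(n_{\alpha_2}),(p_{\alpha_3})$ in $E$ converging in the $w^*$-topology to $m,n,p$ respectively, $\pi^i(m,n,p)=w^*\text{-}\lim_{\alpha_{\sigma_i(1)}}\lim_{\alpha_{\sigma_i(2)}}\lim_{\alpha_{\sigma_i(3)}}\pi(m_{\alpha_1},n_{\alpha_2},p_{\alpha_3})$ (all limits in the $w^*$-topology, the rightmost limit taken first; the result does not depend on the nets), where $(\sigma_i(1),\sigma_i(2),\sigma_i(3))$ is $(1,2,3)$ for $i=0$, $(1,3,2)$ for $i=1$, $(3,2,1)$ for $i=2$, $(2,1,3)$ for $i=3$, $(3,1,2)$ for $i=4$, $(2,3,1)$ for $i=5$. The system $(E,\pi)$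 is called Aron--Berner regular if $\pi^0=\pi^1=\dots=\pi^5$ on $E^{**}\times E^{**}\times E^{**}$. *)

(* Defs.v *)
From HB Require Import structures.
From mathcomp Require Import all_boot all_order all_algebra.
From mathcomp Require Import all_classical all_reals topology normedtype.
From mathcomp Require Import complex.

Set Implicit Arguments.
Unset Strict Implicit.
Unset Printing Implicit Defensive.

Import Order.TTheory GRing.Theory Num.Theory.
Import numFieldNormedType.Exports.
Local Open Scope classical_set_scope.
Local Open Scope ring_scope.
Local Open Scope complex_scope.

Section complex_norm.
Variable R : realType.
Implicit Types (E : normedModType R[i]) (z : R[i]).

Lemma normE_Re E (x : E) : `|x| = (complex.Re `|x|)%:C.
Proof.
have := ger0_Im (normr_ge0 x); case: `|x| => a b /= ->; by [].
Qed.

Lemma normRe_ge0 E (x : E) : 0 <= complex.Re `|x|.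
Proof. by rewrite -ler0c -normE_Re. Qed.

Lemma posE z : 0 < z -> z = (complex.Re z)%:C.
Proof. by case: z => a b; rewrite ltcE /= => /andP[/eqP -> _]. Qed.

Lemma normc_le_ReIm z :
  `|z| <= (`|complex.Re z| + `|complex.Im z|)%:C.
Proof.
rewrite normc_def lecR.
apply: (le_trans (y := Num.sqrt ((`|complex.Re z| + `|complex.Im z|) ^+ 2))).
  rewrite ler_wsqrtr // sqrrD !real_normK ?num_real // addrAC lerDl.
  by rewrite mulrn_wge0 // mulr_ge0.
by rewrite sqrtr_sqr ger0_norm // addr_ge0.
Qed.

Lemma complex_complete (F : set_system R[i]^o) : ProperFilter F ->
  cauchy F -> cvg F.
Proof.
move=> FF /cauchyP Fc.
have Rec (f : R[i] -> R) : (forall x y, `|f x - f y|%:C <= `|x - y|) ->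
    cvg (f @ F).
  move=> flip; apply: cauchy_cvg; apply: cauchy_exP => e e0.
  have e0' : 0 < e%:C by rewrite ltcR.
  have [x Fx] := Fc _ e0'.
  exists (f x); rewrite /fmap /=; apply: filterS Fx => y.
  rewrite /ball /= /ball_ /= => xy; rewrite -ltcR.
  exact: le_lt_trans (flip x y) xy.
have /Rec Rcvg : forall x y : R[i], `|complex.Re x - complex.Re y|%:C <= `|x - y|.
  by move=> x y; rewrite -raddfB /= normc_ge_Re.
have /Rec Icvg : forall x y : R[i], `|complex.Im x - complex.Im y|%:C <= `|x - y|.
  move=> x y; rewrite -raddfB normc_def lecR -sqrtr_sqr ler_wsqrtr //.
  by rewrite lerDr sqr_ge0.
apply/cvg_ex; exists (lim (@complex.Re R @ F) +i* lim (@complex.Im R @ F)).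
apply/(@cvgrPdist_lt _ R[i]^o) => e e0.
have eE := posE e0; set r := complex.Re e in eE.
have r0 : 0 < r by rewrite -ltcR -eE.
have r20 : 0 < r / 2 by rewrite divr_gt0.
have /cvgrPdist_lt/(_ _ r20) Rn := Rcvg.
have /cvgrPdist_lt/(_ _ r20) In := Icvg.
near=> z.
apply: le_lt_trans (normc_le_ReIm _) _; rewrite eE ltcR [ltRHS]splitr !raddfB /=.
by rewrite ltrD //; [near: z; exact: Rn|near: z; exact: In].
Unshelve. all: by end_near. Qed.

End complex_norm.

(* The topological dual E^*, with the operator norm.  A norm over R[i] takes its
   values in R[i], whence the real parts and the injection %:C in dual_norm. *)
Section dual.
Variables (R : realType) (E : normedModType R[i]).

Definition continuous_linear : {pred E -> R[i]^o} :=
  mem [set f : E -> R[i]^o | linear f /\ continuous f].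

Record dual := Dual {
  dual_fun :> E -> R[i]^o;
  dual_subproof : dual_fun \in continuous_linear }.

HB.instance Definition _ := [isSub for dual_fun].
HB.instance Definition _ := [Choice of dual by <:].

Lemma continuous_linear_submod : submod_closed continuous_linear.
Proof.
split=> [|k f g].
  by apply/mem_set; split=> [k x y|x]; [rewrite scaler0 addr0|exact: cvg_cst].
move=> /set_mem[fl fc] /set_mem[gl gc]; apply/mem_set.
split=> [l x y|x].
  rewrite !addrfctE !scalrfctE fl gl !scalerDr addrACA.
  by rewrite !scalerA [k * l]mulrC.
by apply: cvgD; [apply: cvgZr; exact: fc|exact: gc].
Qed.

HB.instance Definition _ := GRing.isSubmodClosed.Build R[i] (E -> R[i]^o)
  continuous_linear continuous_linear_submod.
HB.instance Definition _ := [SubChoice_isSubLmodule of dual by <:].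

Implicit Types (f g : dual) (x y : E).

Lemma dualP f g : (forall x, f x = g x) -> f = g.
Proof. by move=> fg; apply/val_inj/funext. Qed.

Lemma dual_linear f : linear f.
Proof. by case: f => f /= /[!inE] -[]. Qed.

Lemma dual_continuous f : continuous f.
Proof. by case: f => f /= /[!inE] -[]. Qed.

HB.instance Definition _ f := GRing.isLinear.Build R[i] E R[i]^o *:%R
  (dual_fun f) (dual_linear f).

Lemma dual_bounded f : exists2 M : R, 0 <= M &
  forall x, `|f x| <= M%:C * `|x|.
Proof.
have /linear_boundedP/pinfty_ex_gt0[M M0 fM] :=
  continuous_linear_bounded 0 (@dual_continuous f 0).
by exists (complex.Re M); [rewrite -ler0c -posE // ltW|rewrite -posE].
Qed.

Definition dual_norm f : R[i] :=
  (sup [set complex.Re `|f x| | x in [set x : E | `|x| <= 1]])%:C.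

Lemma dual_norm_le f (M : R) : (forall x, `|x| <= 1 -> `|f x| <= M%:C) ->
  dual_norm f <= M%:C.
Proof.
move=> fM; rewrite lecR; apply: sup_le_ub.
  by exists (complex.Re `|f 0|), 0 => //=; rewrite normr0.
by move=> _ [x x1 <-]; rewrite -lecR -normE_Re; exact: fM.
Qed.

Lemma dual_norm_has_sup f :
  has_sup [set complex.Re `|f x| | x in [set x : E | `|x| <= 1]].
Proof.
split; first by exists (complex.Re `|f 0|), 0 => //=; rewrite normr0.
have [M M0 fM] := dual_bounded f; exists M => _ [y y1 <-].
by rewrite -lecR -normE_Re (le_trans (fM y)) // ler_piMr // ler0c.
Qed.

Lemma dual_norm_ge0 f : 0 <= dual_norm f.
Proof.
rewrite ler0c; apply: sup_ubound; first by case: (dual_norm_has_sup f).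
by exists 0; [rewrite /= normr0|rewrite linear0 normr0].
Qed.

Lemma le_dual_norm f x : `|f x| <= dual_norm f * `|x|.
Proof.
have [->|x0] := eqVneq x 0; first by rewrite raddf0 !normr0 mulr0.
have nx : 0 < `|x| by rewrite normr_gt0.
rewrite -ler_pdivrMr // mulrC -[X in X * _]ger0_norm ?invr_ge0 //.
rewrite -[leLHS](@normrZ _ R[i]^o) -linearZ [leLHS]normE_Re lecR.
apply: sup_ubound; first by case: (dual_norm_has_sup f).
by exists (`|x|^-1 *: x) => //; rewrite /= normfZV.
Qed.

Lemma ler_dual_normD f g : dual_norm (f + g) <= dual_norm f + dual_norm g.
Proof.
rewrite -rmorphD /=; apply: dual_norm_le => x x1.
apply: (le_trans (ler_normD (f x) (g x))); rewrite rmorphD lerD //.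
  by apply: le_trans (le_dual_norm f x) _; rewrite ler_piMr ?dual_norm_ge0.
by apply: le_trans (le_dual_norm g x) _; rewrite ler_piMr ?dual_norm_ge0.
Qed.

Lemma dual_normZ_le (k : R[i]) f : dual_norm (k *: f) <= `|k| * dual_norm f.
Proof.
rewrite [`|k|](@normE_Re _ R[i]^o) -rmorphM /=; apply: dual_norm_le => x x1.
rewrite -[leLHS]/(`|k * f x|) normrM rmorphM /= -(@normE_Re _ R[i]^o).
rewrite ler_wpM2l // (le_trans (le_dual_norm f x)) //.
by rewrite ler_piMr ?dual_norm_ge0.
Qed.

Lemma dual_normZ (k : R[i]) f : dual_norm (k *: f) = `|k| * dual_norm f.
Proof.
apply/eqP; rewrite eq_le dual_normZ_le /=.
have [->|k0] := eqVneq k 0; first by rewrite normr0 mul0r dual_norm_ge0.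
have := dual_normZ_le k^-1 (k *: f).
by rewrite scalerA mulVf // scale1r normfV ler_pdivlMl ?normr_gt0.
Qed.

Lemma dual_norm0_eq0 f : dual_norm f = 0 -> f = 0.
Proof.
move=> f0; apply: dualP => x; apply/eqP.
by rewrite -normr_le0 (le_trans (le_dual_norm f x)) // f0 mul0r.
Qed.

HB.instance Definition _ := Lmodule_isNormed.Build R[i] dual
  ler_dual_normD dual_normZ dual_norm0_eq0.

Lemma dual_complete (F : set_system dual) : ProperFilter F ->
  cauchy F -> cvg F.
Proof.
move=> FF /cauchy_ballP Fc.
have lip f g x : `|f x - g x| <= `|f - g| * `|x|.
  exact: (le_dual_norm (f - g) x).
have ptcvg x : cvg ((fun f : dual => f x) @ F).
  apply: complex_complete; apply: cauchy_exP => e e0.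
  have [x0|x0] := eqVneq x 0.
    exists 0; rewrite /fmap /=; apply: filterE => f /=.
    by rewrite x0 linear0; exact: ballxx.
  have nx : 0 < `|x| by rewrite normr_gt0.
  have /nearP_dep Fe := Fc _ (divr_gt0 e0 nx).
  near F => f; exists (f x).
  have : \forall g \near F, ball f (e / `|x|) g by near: f; exact: Fe.
  rewrite /fmap /=; apply: filterS => g.
  rewrite -ball_normE /= -ball_normE /= ltr_pdivlMr //; exact: le_lt_trans.
pose g x : R[i]^o := lim ((fun f : dual => f x) @ F).
have gcvg x : (fun f : dual => f x) @ F --> g x by exact: ptcvg.
have fg (e : R[i]) : 0 < e ->
    \forall f \near F, forall x, `|(f : dual) x - g x| <= e * `|x|.
  move=> e0; have /nearP_dep := Fc _ e0; apply: filterS => f Fe x.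
  have cv : (fun h : dual => f x - h x) @ F --> f x - g x.
    by apply: cvgB; [exact: cvg_cst|exact: gcvg].
  apply/ler_addgt0Pr => d d0.
  have /cvgrPdist_lt/(_ _ d0) Fd := cv.
  near F => h.
  rewrite -(subrK (f x - h x) (f x - g x)).
  rewrite (le_trans (ler_normD _ _)) // addrC lerD //.
    have fh : ball f e h by near: h.
    rewrite -ball_normE /= in fh.
    by rewrite (le_trans (lip _ _ _)) // ler_wpM2r // ltW.
  by apply: ltW; near: h.
have glin : linear g.
  move=> k x y; apply: (cvg_lim (@norm_hausdorff _ _)).
  under eq_fun do rewrite linearP.
  by apply: cvgD; [apply: cvgZr|]; exact: gcvg.
pose gL := GRing.isLinear.Build _ _ _ _ g glin.
pose gl : {linear E -> R[i]^o} := HB.pack g gL.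
have gcont : continuous g.
  apply: (@bounded_linear_continuous _ _ _ gl); apply/linear_boundedP.
  near F => f; have [M M0 fM] := dual_bounded f.
  have fg1 : forall x, `|f x - g x| <= 1 * `|x| by near: f; exact: fg.
  near=> r => x; apply: (@le_trans _ _ ((M%:C + 1) * `|x|)).
    have -> : gl x = f x - (f x - g x) by rewrite opprB addrC subrK.
    by rewrite mulrDl (le_trans (ler_normB _ _)) // lerD.
  rewrite ler_wpM2r //; near: r; apply: nbhs_pinfty_ge.
  by rewrite ger0_real // addr_ge0 // ler0c.
have gP : g \in continuous_linear by rewrite inE.
apply/cvg_ex; exists (Dual gP); apply/cvgrPdist_le => e e0.
have := fg _ e0; apply: filterS => f fge; rewrite distrC.
rewrite (posE e0); apply: dual_norm_le => x x1; rewrite -posE //.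
by rewrite (le_trans (fge x)) // ler_piMr // ltW.
Unshelve. all: by end_near. Qed.

HB.instance Definition _ := Uniform_isComplete.Build dual dual_complete.
End dual.

Arguments dual {R} E.

Notation bidual E := (dual (dual E)).

Section evaluation.
Variables (R : realType) (E : normedModType R[i]).

Lemma evaluation_subproof (x : E) :
  (fun phi : dual E => phi x) \in @continuous_linear R (dual E).
Proof.
have evl : linear (fun phi : dual E => phi x : R[i]^o) by [].
pose evL := GRing.isLinear.Build _ _ _ _ _ evl.
pose ev : {linear dual E -> R[i]^o} := HB.pack (fun phi : dual E => phi x) evL.
rewrite inE; split=> //.
apply: (@bounded_linear_continuous _ _ _ ev); apply/linear_boundedP.
near=> r => phi; apply: (le_trans (le_dual_norm phi x)); rewrite mulrC.
rewrite ler_wpM2r ?dual_norm_ge0 //.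
by near: r; apply: nbhs_pinfty_ge; exact: normr_real.
Unshelve. all: by end_near. Qed.

Definition evaluation (x : E) : bidual E := Dual (evaluation_subproof x).

End evaluation.

(* The w^*-topology of E^** is the topology of pointwise convergence on E^*. *)
Definition wstar_cvg (R : realType) (E : normedModType R[i]) (T : Type)
    (F : set_system T) (u : T -> bidual E) (m : bidual E) : Prop :=
  {ptws, (fun t => u t : dual E -> R[i]^o) @ F --> (m : dual E -> R[i]^o)}.

Lemma wstar_cvgP (R : realType) (E : normedModType R[i]) (T : Type)
    (F : set_system T) (FF : Filter F) (u : T -> bidual E) (m : bidual E) :
  wstar_cvg F u m <-> forall phi : dual E, u t phi @[t --> F] --> m phi.
Proof. by rewrite /wstar_cvg; apply: (@iff_trans _ _ _ (pointwise_cvgP _ _)). Qed.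

Record directed_set := DirectedSet {
  directed_sort :> Type;
  directed_le : directed_sort -> directed_sort -> Prop;
  directed_point : directed_sort;
  directed_le_refl : forall a, directed_le a a;
  directed_le_trans : forall a b c,
    directed_le a b -> directed_le b c -> directed_le a c;
  directed_ub : forall a b, exists2 c, directed_le a c & directed_le b c }.

Definition eventually_in (D : directed_set) : set_system D :=
  [set A | exists a, forall b, directed_le a b -> A b].

#[global] Instance eventually_in_filter (D : directed_set) :
  ProperFilter (@eventually_in D).
Proof.
apply: Build_ProperFilter => [[a Aa]|].
  exact: Aa (directed_le_refl a).
split; first by exists (directed_point D).
- move=> A B [a Aa] [b Bb]; have [c ac bc] := directed_ub a b.
  exists c => d cd; split; [apply: Aa|apply: Bb];
    exact: directed_le_trans cd.
- by move=> A B AB [a Aa]; exists a => b /Aa /AB.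
Qed.

Section aron_berner.
Variables (R : realType) (E : normedModType R[i]).
Implicit Types (D : directed_set) (m n p q : bidual E).

Definition bounded_net_to D (u : D -> E) m : Prop :=
  bounded_set (range u) /\
  wstar_cvg (@eventually_in D) (fun a => evaluation (u a)) m.

(* iterated_wstar_lim T q : w^*-lim_a w^*-lim_b w^*-lim_c T a b c exists and
   equals q, the limit over c being taken first. *)
Definition iterated_wstar_lim D1 D2 D3 (T : D1 -> D2 -> D3 -> E) q : Prop :=
  exists (r : D1 -> bidual E) (s : D1 -> D2 -> bidual E),
    [/\ forall a b,
          wstar_cvg (@eventually_in D3) (fun c => evaluation (T a b c)) (s a b),
        forall a, wstar_cvg (@eventually_in D2) (s a) (r a)
      & wstar_cvg (@eventually_in D1) r q].

Variable pi : E -> E -> E -> E.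

Definition aron_berner_value (i : 'I_6) m n p q : Prop :=
  forall (D1 D2 D3 : directed_set) (u : D1 -> E) (v : D2 -> E) (w : D3 -> E),
    bounded_net_to u m -> bounded_net_to v n -> bounded_net_to w p ->
    match nat_of_ord i with
    | 0%N => iterated_wstar_lim (fun a b c => pi (u a) (v b) (w c)) q
    | 1%N => iterated_wstar_lim (fun a c b => pi (u a) (v b) (w c)) q
    | 2%N => iterated_wstar_lim (fun c b a => pi (u a) (v b) (w c)) q
    | 3%N => iterated_wstar_lim (fun b a c => pi (u a) (v b) (w c)) q
    | 4%N => iterated_wstar_lim (fun c a b => pi (u a) (v b) (w c)) q
    | _ => iterated_wstar_lim (fun b c a => pi (u a) (v b) (w c)) q
    end.

(* The i-th Aron--Berner extension: the common value q of the i-th iterated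
   limit along all bounded nets w^*-converging to m, n, p.  When pi is the
   triple product of a Jordan Banach triple, such a q exists, and it is unique
   since, by Goldstine's theorem, m, n and p are w^*-limits of bounded nets
   of E; the default value 0 is then never used. *)
Definition aron_berner (i : 'I_6) m n p : bidual E :=
  xget 0 [set q | aron_berner_value i m n p q].

Definition aron_berner_regular : Prop :=
  forall (i j : 'I_6) m n p, aron_berner i m n p = aron_berner j m n p.

End aron_berner.

Record jordan_banach_triple (R : realType) (E : completeNormedModType R[i])
    (pi : E -> E -> E -> E) : Prop := JordanBanachTriple {
  jbt_linear1 : forall b c, linear (fun a => pi a b c);
  jbt_linear3 : forall a b, linear (fun c => pi a b c);
  jbt_symmetric : forall a b c, pi a b c = pi c b a;
  jbt_conj_linear2 : forall a c (k : R[i]) b b',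
    pi a (k *: b + b') c = k^* *: pi a b c + pi a b' c;
  jbt_continuous : continuous (fun x : E * E * E => pi x.1.1 x.1.2 x.2);
  jbt_jordan : forall a b c d e,
    pi a b (pi c d e) =
    pi (pi a b c) d e - pi c (pi b a d) e + pi c d (pi a b e) }.

(* Main.v *)
Require Import Defs.
From HB Require Import structures.
From mathcomp Require Import all_boot all_order all_algebra.
From mathcomp Require Import all_classical all_reals topology normedtype.
From mathcomp Require Import complex ring lra.

Set Implicit Arguments.
Unset Strict Implicit.
Unset Printing Implicit Defensive.

Import Order.TTheory GRing.Theory Num.Theory.
Import numFieldNormedType.Exports.
Local Open Scope classical_set_scope.
Local Open Scope ring_scope.
Local Open Scope complex_scope.

(** Write P for pi^0.  Reading the iterated limit from the inside out, each stage
applies an element of the bidual to a bounded linear or conjugate linear form on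
E, so pi^0(m, n, p)(phi) is Arens' expression: apply p to z |-> phi(pi(x, y, z)),
then n to the resulting form in y, then m to the resulting form in x, with
conjugations in the middle (triple_extension, triple_extension_lim).  Two facts
come for free: |P(m, n, p)| <= K |m| |n| |p|, and the outermost variable m enters
only through m(psi) for some psi in the dual of E depending on n, p and phi: the
map m |-> P(m, n, p) has a preadjoint, or equivalently is linear and continuous
for the weak-star topologies.

Regularity brings each variable to the outermost place.  Since pi is symmetric in
its outer variables, pi^2(m, n, p) = pi^0(p, n, m), so pi^0 = pi^2 says that P is
symmetric, hence has a preadjoint in its third variable; and pi^0 = pi^3, where
the limit over the middle variable is outermost, gives a (conjugate) preadjoint
in the second.  A map with a preadjoint is determined by its values on E
(preadjoint_ext), so the Jordan identity, whose terms are compositions of such maps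
in each of the five variables, passes from E to its bidual one variable at a time
(jordan_extension).  Linearity is built into having a preadjoint, and joint
continuity is the norm bound.

Because the extensions are described through all bounded nets converging to m, n
and p, identifying one with P also requires that such nets exist, which is
Goldstine's theorem in its weak form.  It is obtained without the Hahn-Banach
theorem, by a least squares argument on a ball (exists_small_misfit). *)

(** * Weak-star density of balls of E in the bidual *)

Definition sqnorm (R : realType) (z : R[i]) : R :=
  complex.Re z ^+ 2 + complex.Im z ^+ 2.

Section goldstine.
Variables (R : realType) (E : normedModType R[i]).
Implicit Types (m : bidual E) (phi : dual E) (s : seq (dual E)).

Lemma sqnorm_norm (z : R[i]) : (sqnorm z)%:C = `|z| ^+ 2.
Proof. exact: add_Re2_Im2. Qed.

Lemma sqnorm_ge0 (z : R[i]) : 0 <= sqnorm z.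
Proof. by rewrite addr_ge0 // sqr_ge0. Qed.

Lemma sqnormB (t : R) (a b : R[i]) : sqnorm (a - t%:C * b) =
  sqnorm a - 2 * t * complex.Re (a^* * b) + t ^+ 2 * sqnorm b.
Proof. by case: a b => [a1 a2] [b1 b2]; rewrite /sqnorm /=; ring. Qed.

Lemma dual_sumE (I : Type) (r : seq I) (f : I -> dual E) x :
  (\sum_(j <- r) f j) x = \sum_(j <- r) f j x.
Proof. by elim/big_rec2: _ => // j y g _ <-. Qed.

(** How badly x, tested against the functionals in s, fails to represent m. *)
Definition misfit m s (x : E) : R := \sum_(phi <- s) sqnorm (m phi - phi x).

(** Up to a factor -2, the gradient at x of the misfit, a quadratic function of x
on the underlying real space (see misfit_move). *)
Definition misfit_slope m s (x : E) : dual E :=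
  \sum_(phi <- s) (m phi - phi x)^* *: phi.

Lemma misfit_move m s x v (t : R) : misfit m s (x + t%:C *: v) =
  misfit m s x - 2 * t * complex.Re (misfit_slope m s x v)
  + t ^+ 2 * \sum_(phi <- s) sqnorm (phi v).
Proof.
rewrite dual_sumE /misfit raddf_sum !mulr_sumr -sumrB -big_split /=.
by apply: eq_bigr => phi _; rewrite linearD linearZ opprD addrA sqnormB.
Qed.

(** The slope functional at x separates m from x by the misfit; when x nearly
minimises the misfit on a ball, it separates m from the whole ball. *)
Lemma misfit_slope_gap m s x :
  complex.Re (m (misfit_slope m s x)) - complex.Re (misfit_slope m s x x)
  = misfit m s x.
Proof.
rewrite dual_sumE linear_sum /= -raddfB -sumrB raddf_sum /=.
apply: eq_bigr => phi _; rewrite linearZ /=.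
have -> : (m phi - phi x)^* *: m phi - ((m phi - phi x)^* *: phi) x =
   (m phi - phi x)^* * (m phi - phi x) by rewrite mulrBr.
by case: (m phi - phi x) => a b; rewrite /sqnorm /=; ring.
Qed.

Lemma sqnorm_sum_bounded s (r : R) : 0 <= r ->
  exists2 B : R, 0 <= B &
    forall v : E, `|v| <= r%:C -> \sum_(phi <- s) sqnorm (phi v) <= B.
Proof.
move=> r0; elim: s => [|phi s [B B0 sB]].
  by exists 0 => // v _; rewrite big_nil.
have [M M0 phiM] := dual_bounded phi.
exists ((M * r) ^+ 2 + B) => [|v vr]; first by rewrite addr_ge0 ?sqr_ge0.
rewrite big_cons lerD ?sB // -lecR sqnorm_norm rmorphXn /=.
rewrite ler_pXn2r ?nnegrE //; last by rewrite ler0c mulr_ge0.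
by rewrite (le_trans (phiM v)) // rmorphM ler_wpM2l ?ler0c.
Qed.

(** A ball is invariant under rotations by unit complex numbers, so that bounding
real parts on it bounds the norm. *)
Lemma Re_bound_dual_norm phi (C M : R) : 0 < C ->
  (forall y : E, `|y| <= C%:C -> complex.Re (phi y) <= M) ->
  C%:C * dual_norm phi <= M%:C.
Proof.
move=> C0 phiM; rewrite mulrC -ler_pdivlMr ?ltcR // -fmorphV -rmorphM /=.
apply: dual_norm_le => x x1; rewrite rmorphM fmorphV ler_pdivlMr ?ltcR //.
have [px0|px0] := eqVneq (phi x) 0.
  rewrite px0 normr0 mul0r ler0c; have := phiM 0.
  by rewrite linear0 normr0 ler0c ltW //; apply.
have np : `|phi x| != 0 by rewrite normr_eq0.
(* Rotating x by k makes phi x equal to its modulus. *)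
pose k := (phi x)^* / `|phi x|.
have k1 : `|k| = 1 by rewrite normrM normfV normr_id normcJ divff.
have kphi : k * phi x = `|phi x|.
  by rewrite /k mulrAC mulrC [_^* * _]mulrC -sqr_normc expr2 mulrA mulVf ?mul1r.
have := phiM ((C%:C * k) *: x).
rewrite linearZ /= -[_ *: phi x]/(_ * phi x) -mulrA kphi => h.
rewrite mulrC (@normE_Re _ R[i]^o) -rmorphM lecR /=.
apply: le_trans (h _).
  by rewrite [`|phi x|](@normE_Re _ R[i]^o) -rmorphM.
have C0' : 0 <= C%:C by rewrite ler0c ltW.
by rewrite normrZ normrM k1 mulr1 (ger0_norm C0') ler_piMr.
Qed.

(** Let x nearly minimise the misfit on the ball of radius C, and suppose that the
misfit there is at least 1.  Moving a small step t towards any other point y of the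
ball cannot lower the misfit much, so the slope functional psi satisfies
Re psi(y) <= Re psi(x) + 1/2 = Re m(psi) - misfit + 1/2 <= Re m(psi) - 1/2.
Taking the supremum over y gives C |psi| <= |m| |psi| - 1/2, against |m| < C. *)
Lemma exists_small_misfit m s (C : R) : `|m| < C%:C ->
  exists2 x : E, `|x| <= C%:C & misfit m s x < 1.
Proof.
move=> mC.
have C0 : 0 < C by rewrite -ltcR (le_lt_trans (normr_ge0 m)).
apply: contrapT => nox.
have Q1 x : `|x| <= C%:C -> 1 <= misfit m s x.
  by move=> xC; rewrite leNgt; apply/negP => xQ; apply: nox; exists x.
have [|B B0 sB] := @sqnorm_sum_bounded s (C + C); first by rewrite addr_ge0 ?ltW.
pose A := [set misfit m s x | x in [set x : E | `|x| <= C%:C]].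
have hA : has_inf A.
  split; first by exists (misfit m s 0), 0 => //=; rewrite normr0 ler0c ltW.
  by exists 1 => _ [x xC <-]; exact: Q1.
(* B bounds the second order term along a unit step; x is taken optimal up to
   t ^+ 2, so that this error and the second order term t ^+ 2 * B add up to t. *)
pose t := (1 + B)^-1.
have t0 : 0 < t by rewrite invr_gt0 ltr_wpDr.
have [_ [x xC <-] xA] := @inf_adherent _ A (t ^+ 2) (exprn_gt0 _ t0) hA.
have slope y : `|y| <= C%:C ->
    complex.Re (misfit_slope m s x y) <=
    complex.Re (misfit_slope m s x x) + 1 / 2.
  move=> yC.
  have t1 : t <= 1 by rewrite invf_le1 ?lerDl // ltr_wpDr.
  have zC : `|x + t%:C *: (y - x)| <= C%:C.
    have -> : x + t%:C *: (y - x) = (1 - t)%:C *: x + t%:C *: y.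
      by rewrite rmorphB scalerBr scalerBl scale1r addrA addrAC.
    rewrite (le_trans (ler_normD _ _)) // !normrZ !ger0_norm ?ler0c ?subr_ge0 //;
      last exact: ltW.
    rewrite [leRHS](_ : _ = (1 - t)%:C * C%:C + t%:C * C%:C); last first.
      by rewrite -mulrDl -rmorphD subrK mul1r.
    by rewrite lerD // ler_wpM2l // ler0c ?subr_ge0 // ltW.
  have vB : \sum_(phi <- s) sqnorm (phi (y - x)) <= B.
    by apply: sB; rewrite (le_trans (ler_normB _ _)) // rmorphD lerD.
  have : inf A <= misfit m s (x + t%:C *: (y - x)).
    by apply: (ge_inf hA.2); exists (x + t%:C *: (y - x)).
  rewrite misfit_move linearB raddfB /=.
  set a := complex.Re _; set b := complex.Re _; set S := \sum_(_ <- _) _ in vB *.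
  move=> Ale.
  have : 2 * t * (a - b) < t ^+ 2 * (1 + B).
    by have := ler_wpM2l (sqr_ge0 t) vB; lra.
  have -> : t ^+ 2 * (1 + B) = t * 1.
    by rewrite expr2 -mulrA mulVf // gt_eqF // ltr_wpDr.
  rewrite mulrAC mulrC ltr_pM2l //; lra.
have := Re_bound_dual_norm C0 slope.
have := misfit_slope_gap m s x; have := Q1 x xC.
set psi := misfit_slope m s x => Qx gap bound.
have mpsi : complex.Re (m psi) <= C * complex.Re (dual_norm psi).
  rewrite -lecR rmorphM /= -(@normE_Re _ (dual E)).
  apply: (@le_trans _ _ (`|m| * `|psi|)); last by rewrite ler_wpM2r // ltW.
  apply: le_trans (le_dual_norm m psi).
  by apply: le_trans (normc_ge_Re _); rewrite lecR ler_norm.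
move: bound; rewrite [dual_norm psi](@normE_Re _ (dual E)) -rmorphM lecR.
lra.
Qed.

(** A precision e at phi is a precision 1 at e^-1 *: phi, so that finite sets of
tests also encode precisions. *)
Definition finite_tests : directed_set.
Proof.
refine (@DirectedSet (seq (dual E)) (fun s s' => {subset s <= s'}) [::] _ _ _).
- by move=> s phi.
- by move=> s1 s2 s3 s12 s23 phi /s12/s23.
- move=> s1 s2; exists (s1 ++ s2) => phi; rewrite mem_cat => -> //.
  exact: orbT.
Defined.


(** Goldstine's theorem in the form needed here: only boundedness of the net is
claimed, not the sharp bound |m|, so that any radius above |m| does. *)
Lemma goldstine m : exists (D : directed_set) (u : D -> E), bounded_net_to u m.
Proof.
pose C : R := complex.Re `|m| + 1.
have mC : `|m| < C%:C by rewrite [`|m|]normE_Re ltcR ltrDl.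
have /choice[u uP] : forall s, exists x : E, `|x| <= C%:C /\ misfit m s x < 1.
  by move=> s; have [x xC xs] := exists_small_misfit s mC; exists x.
exists finite_tests, u; split.
  exists C%:C; split; first exact/ger0_real/ltW/(le_lt_trans _ mC).
  by move=> x Cx _ [s _ <-] /=; rewrite (le_trans (uP s).1) // ltW.
apply/wstar_cvgP => phi; apply/(@cvgrPdist_lt _ R[i]^o) => e e0.
exists [:: e^-1 *: phi] => s /(_ _ (mem_head _ _)) sphi /=.
have e0' : 0 < e^-1 by rewrite invr_gt0.
have: sqnorm (e^-1 * (m phi - phi (u s))) < 1.
  apply: le_lt_trans (uP s).2; rewrite /misfit (big_rem _ sphi) /=.
  have -> : m (e^-1 *: phi) - (e^-1 *: phi) (u s) = e^-1 * (m phi - phi (u s)).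
    by rewrite linearZ mulrBr.
  by rewrite lerDl sumr_ge0 // => psi _; exact: sqnorm_ge0.
rewrite -ltcR sqnorm_norm rmorph1 expr_lt1 // normrM gtr0_norm //.
by rewrite mulrC ltr_pdivrMr // mul1r.
Qed.

Lemma wstar_cvg_unique (T : Type) (F : set_system T) (FF : ProperFilter F)
  (u : T -> bidual E) m m' : wstar_cvg F u m -> wstar_cvg F u m' -> m = m'.
Proof.
move=> /wstar_cvgP um /wstar_cvgP um'; apply: dualP => phi.
exact: (cvg_unique (@norm_hausdorff _ R[i]^o)) (um phi) (um' phi).
Qed.

Lemma iterated_wstar_lim_unique (D1 D2 D3 : directed_set)
    (T : D1 -> D2 -> D3 -> E) m m' :
  iterated_wstar_lim T m -> iterated_wstar_lim T m' -> m = m'.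
Proof.
move=> [r [s [Ts sr rm]]] [r' [s' [Ts' sr' rm']]].
have ss' a b : s a b = s' a b by exact: wstar_cvg_unique (Ts a b) (Ts' a b).
have rr' : r = r'.
  apply/funext => a; apply: wstar_cvg_unique (sr a) _.
  by rewrite (_ : s a = s' a) //; apply/funext.
by apply: wstar_cvg_unique rm _; rewrite rr'.
Qed.

(** By Goldstine's theorem there are nets along which any two candidate values are
the same iterated limit. *)
Lemma aron_bernerE (pi : E -> E -> E -> E) i m n p q :
  aron_berner_value pi i m n p q -> aron_berner pi i m n p = q.
Proof.
move=> piq; apply: xget_subset1 => // q1 q2 {q piq}.
have [D1 [u um]] := goldstine m; have [D2 [v vn]] := goldstine n.
have [D3 [w wp]] := goldstine p.
move=> /(_ D1 D2 D3 u v w um vn wp) + /(_ D1 D2 D3 u v w um vn wp).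
by case: i => -[|[|[|[|[|i]]]]] /= _; exact: iterated_wstar_lim_unique.
Qed.

End goldstine.

(** * Semilinear maps and their Arens extensions *)

(** The flag s records conjugate linearity, so that the linear and the conjugate
linear variables of a triple product are treated together. *)
Definition twist (R : realType) (s : bool) (z : R[i]) : R[i] :=
  if s then z^* else z.

Definition semilinear (R : realType) (s : bool) (V W : lmodType R[i])
    (f : V -> W) : Prop :=
  forall (k : R[i]) x y, f (k *: x + y) = twist s k *: f x + f y.

Section twist.
Variables (R : realType) (s : bool).
Implicit Types y z : R[i].

Lemma twistK : involutive (@twist R s).
Proof. by case: s => // z; exact: conjcK. Qed.

Lemma twistD y z : twist s (y + z) = twist s y + twist s z.
Proof. by case: s => //; exact: (rmorphD conjc). Qed.

Lemma twistM y z : twist s (y * z) = twist s y * twist s z.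
Proof. by case: s => //; exact: (rmorphM conjc). Qed.

Lemma twistB y z : twist s (y - z) = twist s y - twist s z.
Proof. by case: s => //; exact: (rmorphB conjc). Qed.

Lemma twistN1 : twist s (-1) = -1 :> R[i].
Proof. by case: s => //; exact: (rmorphN1 conjc). Qed.

Lemma norm_twist z : `|twist s z| = `|z|.
Proof. by case: s => //; exact: normcJ. Qed.

Lemma twist_real (r : R) : twist s r%:C = r%:C.
Proof. by case: s => //; exact: conjc_real. Qed.

Lemma cvg_twist (T : Type) (F : set_system T) (FF : Filter F)
    (f : T -> R[i]^o) (l : R[i]^o) :
  f @ F --> l -> (fun t => twist s (f t) : R[i]^o) @ F --> (twist s l : R[i]^o).
Proof.
move=> /cvgrPdist_lt fl; apply/cvgrPdist_lt => e /fl.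
by apply: filterS => t; rewrite -twistB norm_twist.
Qed.

Lemma semilinear0 (V W : lmodType R[i]) (f : V -> W) : semilinear s f -> f 0 = 0.
Proof.
by move=> fs; have := fs (-1) 0 0; rewrite scaler0 addr0 twistN1 scaleN1r addNr.
Qed.

Lemma semilinearB (V W : lmodType R[i]) (f : V -> W) (x y : V) :
  semilinear s f -> f (x - y) = f x - f y.
Proof.
by move=> fs; rewrite -scaleN1r addrC fs twistN1 scaleN1r addrC.
Qed.

Lemma semilinearZ_real (V W : lmodType R[i]) (f : V -> W) (r : R) (x : V) :
  semilinear s f -> f (r%:C *: x) = r%:C *: f x.
Proof.
by move=> fs; rewrite -[X in f X]addr0 fs twist_real (semilinear0 fs) addr0.
Qed.

End twist.

Section functional.
Variables (R : realType) (X : normedModType R[i]).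

Lemma bounded_continuous_linear (g : X -> R[i]^o) (K : R[i]) :
  linear g -> 0 <= K -> (forall x, `|g x| <= K * `|x|) ->
  g \in @continuous_linear R X.
Proof.
move=> gl K0 gK; pose gL := GRing.isLinear.Build _ _ _ _ g gl.
pose gl' : {linear X -> R[i]^o} := HB.pack g gL.
rewrite inE; split=> //; apply: (@bounded_linear_continuous _ _ _ gl').
apply/linear_boundedP; near=> r => x; apply: le_trans (gK x) _.
by rewrite ler_wpM2r //; near: r; apply: nbhs_pinfty_ge; exact: ger0_real.
Unshelve. all: by end_near. Qed.

(** The zero functional is a junk value, taken when g is not a bounded linear
form. *)
Definition functional (g : X -> R[i]^o) : dual X := insubd (0 : dual X) g.

Lemma functionalE g x : g \in @continuous_linear R X -> functional g x = g x.
Proof. by move=> gP; rewrite /functional -[dual_fun _]/(\val _) insubdK. Qed.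

Lemma dual_norm_bound (f : dual X) (K : R[i]) : 0 <= K ->
  (forall x, `|f x| <= K * `|x|) -> `|f| <= K.
Proof.
move=> K0 fK; have KE : K = (complex.Re K)%:C.
  by rewrite -[LHS]ger0_norm // (@normE_Re _ R[i]^o) ger0_norm.
rewrite KE; apply: dual_norm_le => x x1.
by rewrite -KE (le_trans (fK x)) // ler_piMr.
Qed.

End functional.

Section arens.
Variables (R : realType) (E : normedModType R[i]).
Implicit Types (m : bidual E) (f : E -> R[i]^o) (K : R[i]).

Definition bounded_form s K f : Prop :=
  [/\ semilinear s f, 0 <= K & forall x, `|f x| <= K * `|x|].

(** The weak-star continuous extension of a bounded s-linear form f to the bidual,
evaluated at m; when s is true the dual only contains the conjugate of f. *)
Definition arens s f m : R[i]^o :=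
  twist s (m (functional (fun x => twist s (f x)))).

Lemma bounded_form_dual s K f : bounded_form s K f ->
  (fun x => twist s (f x) : R[i]^o) \in @continuous_linear R E.
Proof.
move=> [fs K0 fK]; apply: (@bounded_continuous_linear _ _ _ K) => // [k x y|x].
  by rewrite fs twistD twistM twistK.
by rewrite norm_twist.
Qed.

Lemma arens_le s K f m : bounded_form s K f -> `|arens s f m| <= K * `|m|.
Proof.
move=> fK; rewrite norm_twist mulrC; apply: le_trans (le_dual_norm m _) _.
have [_ K0 fle] := fK.
rewrite ler_wpM2l ?dual_norm_ge0 //; apply: dual_norm_bound => // x.
by rewrite functionalE ?(bounded_form_dual fK) // norm_twist.
Qed.

Lemma arens_evaluation s K f x :
  bounded_form s K f -> arens s f (evaluation x) = f x.
Proof.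
by move=> fK; rewrite /arens /= functionalE ?(bounded_form_dual fK) // twistK.
Qed.

(** Parameters of f survive the extension with their own type of linearity: this
lets the extension be iterated one variable after the other. *)
Lemma arens_semilinear s s' (V : lmodType R[i]) (t : V -> E -> R[i]^o) m :
  (forall z, semilinear s' (fun x => t x z)) ->
  (forall x, exists K, bounded_form s K (t x)) ->
  semilinear s' (fun x => arens s (t x) m).
Proof.
move=> ts' ts k x y; rewrite /arens.
pose g x := functional (fun z => twist s (t x z)).
have gE x' z : g x' z = twist s (t x' z).
  by have [K tK] := ts x'; rewrite functionalE ?(bounded_form_dual tK).
have -> : functional (fun z => twist s (t (k *: x + y) z)) =
    twist s (twist s' k) *: g x + g y.
  apply: dualP => z; rewrite -[LHS]/(g _ z) gE ts' twistD twistM.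
  by rewrite -!gE.
by rewrite linearP twistD twistM twistK.
Qed.

End arens.

Section preadjoint.
Variables (R : realType) (E : normedModType R[i]).
Implicit Types (m : bidual E) (L : bidual E -> bidual E).

(** L is s-linear and weak-star to weak-star continuous, expressed by its action on
the predual; here psi is the image of phi by the preadjoint of L. *)
Definition has_preadjoint s L : Prop :=
  forall phi, exists psi, forall m, L m phi = twist s (m psi).

Lemma eq_preadjoint s L L' : L =1 L' -> has_preadjoint s L -> has_preadjoint s L'.
Proof.
by move=> LL' Ls phi; have [psi Lpsi] := Ls phi; exists psi => m; rewrite -LL'.
Qed.

Lemma preadjoint_cvg s L (T : Type) (F : set_system T) (FF : Filter F)
  (u : T -> bidual E) m :
  has_preadjoint s L -> wstar_cvg F u m -> wstar_cvg F (fun t => L (u t)) (L m).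
Proof.
move=> Ls /wstar_cvgP um; apply/wstar_cvgP => phi; have [psi Lpsi] := Ls phi.
by under eq_fun do rewrite Lpsi; rewrite Lpsi; apply: cvg_twist; exact: um.
Qed.

(** The functional psi attached to phi is determined by the values psi x, which are
values of L on E. *)
Lemma preadjoint_ext s L L' : has_preadjoint s L -> has_preadjoint s L' ->
  (forall x, L (evaluation x) = L' (evaluation x)) -> forall m, L m = L' m.
Proof.
move=> Ls Ls' LL' m; apply: dualP => phi.
have [psi Lpsi] := Ls phi; have [psi' Lpsi'] := Ls' phi.
rewrite Lpsi Lpsi'; congr (twist s (m _)); apply: dualP => x.
apply: (inv_inj (@twistK R s)).
by rewrite -[psi x]/(evaluation x psi) -Lpsi LL' Lpsi'.
Qed.

Lemma preadjoint_semilinear s L : has_preadjoint s L -> semilinear s L.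
Proof.
move=> Ls k m m'; apply: dualP => phi; have [psi Lpsi] := Ls phi.
rewrite Lpsi -[((_ *: _ + _) : bidual E) phi]/(twist s k * L m phi + L m' phi).
by rewrite !Lpsi -twistM -twistD.
Qed.

Lemma preadjoint_comp s s' L L' : has_preadjoint s L -> has_preadjoint s' L' ->
  has_preadjoint (s (+) s') (fun m => L (L' m)).
Proof.
move=> Ls Ls' phi; have [psi Lpsi] := Ls phi; have [psi' Lpsi'] := Ls' psi.
exists psi' => m; rewrite Lpsi Lpsi'.
by case: s s' {Ls Ls' Lpsi Lpsi'} => -[] //=; exact: conjcK.
Qed.

Lemma preadjointD s L L' : has_preadjoint s L -> has_preadjoint s L' ->
  has_preadjoint s (fun m => L m + L' m).
Proof.
move=> Ls Ls' phi; have [psi Lpsi] := Ls phi; have [psi' Lpsi'] := Ls' phi.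
exists (psi + psi') => m.
by rewrite linearD twistD -Lpsi -Lpsi'.
Qed.

Lemma preadjointB s L L' : has_preadjoint s L -> has_preadjoint s L' ->
  has_preadjoint s (fun m => L m - L' m).
Proof.
move=> Ls Ls' phi; have [psi Lpsi] := Ls phi; have [psi' Lpsi'] := Ls' phi.
exists (psi - psi') => m.
by rewrite linearB twistB -Lpsi -Lpsi'.
Qed.

End preadjoint.

(** * The Arens extension of a bounded triple product *)

Section trilinear.
Variables (R : realType) (E : normedModType R[i]).
Variables (T : E -> E -> E -> E) (s1 s2 s3 : bool) (K : R[i]).
Hypotheses (T1 : forall y z, semilinear s1 (fun x => T x y z))
  (T2 : forall x z, semilinear s2 (fun y => T x y z))
  (T3 : forall x y, semilinear s3 (T x y))
  (K0 : 0 <= K)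
  (TK : forall x y z, `|T x y z| <= K * `|x| * `|y| * `|z|).
Implicit Types (m n p : bidual E) (phi : dual E) (x y z : E).

(** The three stages of the iterated limit: arensk is what remains once the
variables of T from the k-th on have been extended to the bidual. *)
Definition arens3 p x y phi : R[i]^o := arens s3 (fun z => phi (T x y z)) p.
Definition arens2 n p x phi : R[i]^o := arens s2 (fun y => arens3 p x y phi) n.
Definition arens1 m n p phi : R[i]^o := arens s1 (fun x => arens2 n p x phi) m.
Definition triple_extension m n p : bidual E := functional (arens1 m n p).

Lemma dual_semilinear s (f : E -> E) phi :
  semilinear s f -> semilinear s (fun x => phi (f x)).
Proof. by move=> fs k x y; rewrite fs linearP. Qed.

Lemma bounded_form_pairing x y phi :
  bounded_form s3 (`|phi| * K * `|x| * `|y|) (fun z => phi (T x y z)).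
Proof.
split; [exact: dual_semilinear|by rewrite !mulr_ge0|move=> z].
apply: le_trans (le_dual_norm phi _) _.
by rewrite -!mulrA ler_wpM2l ?dual_norm_ge0 // !mulrA.
Qed.

Lemma arens3_phi p x y : semilinear false (arens3 p x y).
Proof.
by apply: arens_semilinear => [z //|phi]; eexists; exact: bounded_form_pairing.
Qed.

Lemma arens3_x p y phi : semilinear s1 (fun x => arens3 p x y phi).
Proof.
apply: arens_semilinear => [z|x]; last by eexists; exact: bounded_form_pairing.
exact: (@dual_semilinear _ (fun x => T x y z)).
Qed.

Lemma bounded_form_arens3 p x phi :
  bounded_form s2 (`|phi| * K * `|x| * `|p|) (fun y => arens3 p x y phi).
Proof.
split; [|by rewrite !mulr_ge0|move=> y].
  apply: arens_semilinear => [z|y]; last by eexists; exact: bounded_form_pairing.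
  exact: (@dual_semilinear _ (fun y => T x y z)).
by rewrite mulrAC; exact: arens_le (bounded_form_pairing x y phi).
Qed.

Lemma arens2_phi n p x : semilinear false (arens2 n p x).
Proof.
apply: arens_semilinear => [y|phi]; last by eexists; exact: bounded_form_arens3.
exact: arens3_phi.
Qed.

Lemma bounded_form_arens2 n p phi :
  bounded_form s1 (`|phi| * K * `|n| * `|p|) (fun x => arens2 n p x phi).
Proof.
split; [|by rewrite !mulr_ge0|move=> x].
  apply: arens_semilinear => [y|x]; last by eexists; exact: bounded_form_arens3.
  exact: arens3_x.
apply: le_trans (arens_le n (bounded_form_arens3 p x phi)) _.
suff -> : `|phi| * K * `|n| * `|p| * `|x| = `|phi| * K * `|x| * `|p| * `|n| by [].
ring.
Qed.

Lemma arens1_phi m n p : semilinear false (arens1 m n p).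
Proof.
apply: arens_semilinear => [x|phi]; last by eexists; exact: bounded_form_arens2.
exact: arens2_phi.
Qed.

Lemma arens1_le m n p phi :
  `|arens1 m n p phi| <= K * `|m| * `|n| * `|p| * `|phi|.
Proof.
apply: le_trans (arens_le m (bounded_form_arens2 n p phi)) _.
suff -> : K * `|m| * `|n| * `|p| * `|phi| = `|phi| * K * `|n| * `|p| * `|m| by [].
ring.
Qed.

Lemma triple_extensionE m n p phi : triple_extension m n p phi = arens1 m n p phi.
Proof.
rewrite functionalE //.
apply: (@bounded_continuous_linear _ _ _ (K * `|m| * `|n| * `|p|)).
- exact: arens1_phi.
- by rewrite !mulr_ge0.
- exact: arens1_le.
Qed.

Lemma triple_extension_le m n p :
  `|triple_extension m n p| <= K * `|m| * `|n| * `|p|.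
Proof.
apply: dual_norm_bound => [|phi]; first by rewrite !mulr_ge0.
by rewrite triple_extensionE arens1_le.
Qed.

Lemma triple_extension_preadjoint1 n p :
  has_preadjoint s1 (fun m => triple_extension m n p).
Proof. by move=> phi; eexists=> m; rewrite triple_extensionE. Qed.

(** When the first variable stays in E its extension is an evaluation, so that the
second one becomes outermost. *)
Lemma triple_extension_preadjoint2 x p :
  has_preadjoint s2 (fun n => triple_extension (evaluation x) n p).
Proof.
move=> phi; eexists=> n.
by rewrite triple_extensionE /arens1 (arens_evaluation _ (bounded_form_arens2 n p phi)).
Qed.

Lemma triple_extension_preadjoint3 x y :
  has_preadjoint s3 (fun p => triple_extension (evaluation x) (evaluation y) p).
Proof.
move=> phi; eexists=> p.
rewrite triple_extensionE /arens1 (arens_evaluation _ (bounded_form_arens2 _ p phi)).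
by rewrite /arens2 (arens_evaluation _ (bounded_form_arens3 p x phi)).
Qed.

Lemma triple_extension_evaluation x y z :
  triple_extension (evaluation x) (evaluation y) (evaluation z)
  = evaluation (T x y z).
Proof.
apply: dualP => phi.
rewrite triple_extensionE /arens1 (arens_evaluation _ (bounded_form_arens2 _ _ phi)).
rewrite /arens2 (arens_evaluation _ (bounded_form_arens3 _ x phi)).
by rewrite /arens3 (arens_evaluation _ (bounded_form_pairing x y phi)).
Qed.

(** Each limit is taken in a variable that has a preadjoint, as those to its left
still range over E. *)
Lemma triple_extension_lim (D1 D2 D3 : directed_set)
    (u : D1 -> E) (v : D2 -> E) (w : D3 -> E) m n p :
  bounded_net_to u m -> bounded_net_to v n -> bounded_net_to w p ->
  iterated_wstar_lim (fun a b c => T (u a) (v b) (w c)) (triple_extension m n p).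
Proof.
move=> [_ um] [_ vn] [_ wp].
exists (fun a => triple_extension (evaluation (u a)) n p).
exists (fun a b => triple_extension (evaluation (u a)) (evaluation (v b)) p).
split=> [a b|a|].
- under [X in wstar_cvg _ X]eq_fun do rewrite -triple_extension_evaluation.
  exact: preadjoint_cvg (triple_extension_preadjoint3 _ _) wp.
- exact: preadjoint_cvg (triple_extension_preadjoint2 _ _) vn.
- exact: preadjoint_cvg (triple_extension_preadjoint1 _ _) um.
Qed.

End trilinear.

(** * Boundedness and joint continuity of semilinear triple products *)

Section continuity.
Variables (R : realType) (V : normedModType R[i]).
Variables (T : V -> V -> V -> V) (s1 s2 s3 : bool).
Hypotheses (T1 : forall y z, semilinear s1 (fun x => T x y z))
  (T2 : forall x z, semilinear s2 (fun y => T x y z))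
  (T3 : forall x y, semilinear s3 (T x y)).

Lemma trilinear_bounded : continuous (fun x : V * V * V => T x.1.1 x.1.2 x.2) ->
  exists2 K : R[i], 0 <= K & forall x y z, `|T x y z| <= K * `|x| * `|y| * `|z|.
Proof.
move=> /(_ (0, 0, 0)); rewrite /continuous_at /= (semilinear0 (T1 _ _)).
move=> /cvgrPdist_lt/(_ 1 ltr01) /nbhs_ballP[d /= d0 dT].
have d20 : 0 < d / 2 by rewrite divr_gt0.
have dE : d / 2 = (complex.Re (d / 2))%:C by exact: posE.
set r := complex.Re (d / 2) in dE.
have Tr x y z : `|x| <= 1 -> `|y| <= 1 -> `|z| <= 1 ->
    `|T (r%:C *: x) (r%:C *: y) (r%:C *: z)| <= 1.
  move=> x1 y1 z1.
  have small v : `|v| <= 1 -> ball (0 : V) d (r%:C *: v).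
    move=> v1; rewrite -ball_normE /= sub0r normrN normrZ -dE gtr0_norm //.
    apply: (@le_lt_trans _ _ (d / 2)); first by rewrite ler_piMr // ltW.
    by rewrite ltr_pdivrMr // ltr_pMr // ltr1n.
  have /ltW := dT (r%:C *: x, r%:C *: y, r%:C *: z)
    (conj (conj (small x x1) (small y y1)) (small z z1)).
  by rewrite /= sub0r normrN.
have rV0 : 0 <= (r%:C ^+ 3)^-1 by rewrite invr_ge0 exprn_ge0 // -dE ltW.
exists (r%:C ^+ 3)^-1 => // x y z.
have r0 : r%:C != 0 by rewrite -dE gt_eqF.
have T1ball x' y' z' : `|x'| <= 1 -> `|y'| <= 1 -> `|z'| <= 1 ->
    `|T x' y' z'| <= (r%:C ^+ 3)^-1.
  move=> x1 y1 z1; have := Tr x' y' z' x1 y1 z1.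
  rewrite (semilinearZ_real _ _ (T1 _ _)) (semilinearZ_real _ _ (T2 _ _)).
  rewrite (semilinearZ_real _ _ (T3 _ _)) !scalerA -expr2 -exprSr.
  rewrite normrZ ger0_norm ?exprn_ge0 -?dE ?(ltW d20) // => h.
  by rewrite -[leRHS]mulr1 ler_pdivlMl // exprn_gt0.
have scale v : exists2 v' : V, `|v'| <= 1 & v = (complex.Re `|v|)%:C *: v'.
  have [->|v0] := eqVneq v 0.
    by exists 0; rewrite ?scaler0 // normr0.
  exists (`|v|^-1 *: v); first by rewrite normfZV.
  by rewrite -normE_Re scalerA mulfV ?scale1r // normr_eq0.
have [x' x1 xE] := scale x; have [y' y1 yE] := scale y.
have [z' z1 zE] := scale z.
rewrite {1}xE {1}yE {1}zE.
rewrite (semilinearZ_real _ _ (T1 _ _)) (semilinearZ_real _ _ (T2 _ _)).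
rewrite (semilinearZ_real _ _ (T3 _ _)) -!normE_Re !normrZ !normr_id.
rewrite -!mulrA [leRHS]mulrC -!mulrA !ler_wpM2l //.
exact: T1ball.
Qed.

(** Telescoping: T a b c - T x y z = T (a - x) y z + T a (b - y) z + T a b (c - z). *)
Lemma trilinear_continuous (K : R[i]) : 0 <= K ->
  (forall x y z, `|T x y z| <= K * `|x| * `|y| * `|z|) ->
  continuous (fun x : V * V * V => T x.1.1 x.1.2 x.2).
Proof.
move=> K0 TK [[a b] c] /=; apply/cvgrPdist_lt => e e0.
pose g (x : V * V * V) : R[i]^o :=
  K * `|a - x.1.1| * `|x.1.2| * `|x.2| + K * `|a| * `|b - x.1.2| * `|x.2|
  + K * `|a| * `|b| * `|c - x.2|.
have g0 : g x @[x --> (a, b, c)] --> (0 : R[i]^o).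
  have <- : g (a, b, c) = 0.
    by rewrite /g /= !subrr normr0 !mulr0 !mul0r !addr0.
  have cvg1 : x.1.1 @[x --> ((a, b, c) : V * V * V)] --> a.
    exact: cvg_comp cvg_fst cvg_fst.
  have cvg2 : x.1.2 @[x --> ((a, b, c) : V * V * V)] --> b.
    exact: cvg_comp cvg_fst cvg_snd.
  have cvg3 : x.2 @[x --> ((a, b, c) : V * V * V)] --> c by exact: cvg_snd.
  have norm_cvg (v : V) (f : V * V * V -> V) : f x @[x --> (a, b, c)] --> v ->
      (`|f x| : R[i]^o) @[x --> (a, b, c)] --> (`|v| : R[i]^o).
    exact: cvg_norm.
  by apply: cvgD; [apply: cvgD|]; repeat (apply: cvgM; last (apply: norm_cvg));
    try exact: cvg_cst; try (by apply: cvgB => //; exact: cvg_cst).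
have /cvgrPdist_lt/(_ _ e0) := g0; apply: filterS => -[[x y] z] /=.
rewrite sub0r normrN; apply: le_lt_trans.
apply: (@le_trans _ _ (g (x, y, z))); last first.
  by rewrite real_ler_norm // ger0_real // !addr_ge0 ?mulr_ge0.
have -> : T a b c - T x y z =
    T (a - x) y z + T a (b - y) z + T a b (c - z).
  rewrite (semilinearB _ _ (T1 _ _)) (semilinearB _ _ (T2 _ _)).
  rewrite (semilinearB _ _ (T3 _ _)).
  by rewrite [X in _ = X + _]addrC subrKA [RHS]addrC subrKA.
rewrite (le_trans (ler_normD _ _)) // lerD //.
by rewrite (le_trans (ler_normD _ _)) // lerD.
Qed.
End continuity.

(** * Passing to the bidual *)

(** The iterated limit of order 2 is that of order 0 read backwards, and reversing
the arguments of pi undoes the reversal. *)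
Lemma aron_berner_value_reverse (R : realType) (E : normedModType R[i])
    (pi : E -> E -> E -> E) (i2 i0 : 'I_6) m n p q :
  (forall a b c, pi a b c = pi c b a) -> i2 = 2%N :> nat -> i0 = 0%N :> nat ->
  aron_berner_value pi i0 p n m q -> aron_berner_value pi i2 m n p q.
Proof.
move=> pisym; rewrite /aron_berner_value => -> -> piq D1 D2 D3 u v w um vn wp.
have := piq D3 D2 D1 w v u wp vn um; congr iterated_wstar_lim.
by apply/funext => c; apply/funext => b; apply/funext => a.
Qed.

Section jordan.
Variables (R : realType) (E : normedModType R[i]).
Variables (pi : E -> E -> E -> E)
  (P : bidual E -> bidual E -> bidual E -> bidual E).
Hypotheses (P1 : forall n p, has_preadjoint false (fun m => P m n p))
  (P2 : forall m p, has_preadjoint true (fun n => P m n p))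
  (P3 : forall m n, has_preadjoint false (P m n))
  (Pevaluation : forall x y z,
    P (evaluation x) (evaluation y) (evaluation z) = evaluation (pi x y z)).
Hypothesis pi_jordan : forall a b c d e,
  pi a b (pi c d e) =
  pi (pi a b c) d e - pi c (pi b a d) e + pi c d (pi a b e).

(** With four of the variables fixed, both sides have a preadjoint in the remaining
one, linear in a, c, e and conjugate linear in b, d: in P c (P b a d) e, for
instance, a passes through the middle place twice.  Hence the identity extends from
E to the bidual in one variable after the other, here from e back to a. *)
Lemma jordan_extension a b c d e :
  P a b (P c d e) = P (P a b c) d e - P c (P b a d) e + P c d (P a b e).
Proof.
pose ev := @evaluation R E.
have evJ x1 x2 x3 x4 x5 : P (ev x1) (ev x2) (P (ev x3) (ev x4) (ev x5)) =
    P (P (ev x1) (ev x2) (ev x3)) (ev x4) (ev x5)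
    - P (ev x3) (P (ev x2) (ev x1) (ev x4)) (ev x5)
    + P (ev x3) (ev x4) (P (ev x1) (ev x2) (ev x5)).
  rewrite !Pevaluation pi_jordan; apply: dualP => phi.
  by rewrite /= linearD linearB.
have evJ5 x1 x2 x3 x4 e' : P (ev x1) (ev x2) (P (ev x3) (ev x4) e') =
    P (P (ev x1) (ev x2) (ev x3)) (ev x4) e'
    - P (ev x3) (P (ev x2) (ev x1) (ev x4)) e'
    + P (ev x3) (ev x4) (P (ev x1) (ev x2) e').
  move: e'; apply: (@preadjoint_ext _ _ false) => [||x]; last exact: evJ.
    exact: (preadjoint_comp (P3 _ _) (P3 _ _)).
  apply: preadjointD; first by apply: preadjointB; exact: P3.
  exact: (preadjoint_comp (P3 _ _) (P3 _ _)).
have evJ4 x1 x2 x3 d' e' : P (ev x1) (ev x2) (P (ev x3) d' e') =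
    P (P (ev x1) (ev x2) (ev x3)) d' e'
    - P (ev x3) (P (ev x2) (ev x1) d') e'
    + P (ev x3) d' (P (ev x1) (ev x2) e').
  move: d'; apply: (@preadjoint_ext _ _ true) => [||x]; last exact: evJ5.
    exact: (preadjoint_comp (P3 _ _) (P2 _ _)).
  apply: preadjointD; last exact: P2.
  by apply: preadjointB; [exact: P2|exact: (preadjoint_comp (P2 _ _) (P3 _ _))].
have evJ3 x1 x2 c' d' e' : P (ev x1) (ev x2) (P c' d' e') =
    P (P (ev x1) (ev x2) c') d' e'
    - P c' (P (ev x2) (ev x1) d') e' + P c' d' (P (ev x1) (ev x2) e').
  move: c'; apply: (@preadjoint_ext _ _ false) => [||x]; last exact: evJ4.
    exact: (preadjoint_comp (P3 _ _) (P1 _ _)).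
  apply: preadjointD; last exact: P1.
  by apply: preadjointB; [exact: (preadjoint_comp (P1 _ _) (P3 _ _))|exact: P1].
have evJ2 x1 b' c' d' e' : P (ev x1) b' (P c' d' e') =
    P (P (ev x1) b' c') d' e'
    - P c' (P b' (ev x1) d') e' + P c' d' (P (ev x1) b' e').
  move: b'; apply: (@preadjoint_ext _ _ true) => [||x]; last exact: evJ3.
    exact: P2.
  apply: preadjointD; last exact: (preadjoint_comp (P3 _ _) (P2 _ _)).
  apply: preadjointB; first exact: (preadjoint_comp (P1 _ _) (P2 _ _)).
  exact: (preadjoint_comp (P2 _ _) (P1 _ _)).
move: a; apply: (@preadjoint_ext _ _ false) => [||x]; last exact: evJ2.
  exact: P1.
apply: preadjointD; last exact: (preadjoint_comp (P3 _ _) (P1 _ _)).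
apply: preadjointB; first exact: (preadjoint_comp (P1 _ _) (P1 _ _)).
exact: (preadjoint_comp (P2 _ _) (P2 _ _)).
Qed.

End jordan.

Theorem proposition3p4 (R : realType) (E : completeNormedModType R[i])
    (pi : E -> E -> E -> E) :
  jordan_banach_triple pi -> aron_berner_regular pi ->
  forall i : 'I_6, jordan_banach_triple (aron_berner pi i).
Proof.
case=> pi1 pi3 pisym pi2 picont pijordan pireg i.
have pil1 b c : semilinear false (fun a => pi a b c) by exact: pi1.
have pil2 a c : semilinear true (fun b => pi a b c) by move=> k; exact: pi2.
have pil3 a b : semilinear false (pi a b) by exact: pi3.
have [K K0 piK] := trilinear_bounded pil1 pil2 pil3 picont.
(* The order 3 is b, a, c: it becomes the order 0 for pi with its first two
   arguments exchanged. *)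
pose pi' b a c := pi a b c.
have piK' b a c : `|pi' b a c| <= K * `|b| * `|a| * `|c|.
  by rewrite [K * _ * _]mulrAC; exact: piK.
have pil1' a c : semilinear true (fun b => pi' b a c) by exact: pil2.
have pil2' b c : semilinear false (fun a => pi' b a c) by exact: pil1.
have pil3' b a : semilinear false (pi' b a) by exact: pil3.
pose P := triple_extension pi false true false.
pose P' := triple_extension pi' true false false.
have P0 : forall m n p, aron_berner pi ord0 m n p = P m n p.
  move=> m n p; apply: aron_bernerE => D1 D2 D3 u v w um vn wp /=.
  exact: (triple_extension_lim pil1 pil2 pil3 K0 piK).
have i6 k : (k < 6)%N -> nat_of_ord (inord k : 'I_6) = k by exact: inordK.
have Psym m n p : P m n p = P p n m.
  rewrite -P0 (pireg ord0 (inord 2)); apply: aron_bernerE.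
  apply: (@aron_berner_value_reverse _ _ _ _ ord0) => //; first exact: i6.
  by move=> D1 D2 D3 u v w um vn wp /=; exact: (triple_extension_lim pil1 pil2 pil3 K0 piK).
have PP' m n p : P m n p = P' n m p.
  rewrite -P0 (pireg ord0 (inord 3)); apply: aron_bernerE.
  move=> D1 D2 D3 u v w um vn wp; rewrite i6 //=.
  exact: (triple_extension_lim pil1' pil2' pil3' K0 piK').
have -> : aron_berner pi i = P.
  apply/funext => m; apply/funext => n; apply/funext => p.
  exact: etrans (pireg i ord0 m n p) (P0 m n p).
have P1 n p : has_preadjoint false (fun m => P m n p).
  exact: (triple_extension_preadjoint1 pil1 pil2 pil3 K0 piK).
have P3 m n : has_preadjoint false (P m n).
  exact (@eq_preadjoint _ _ _ (fun p => P p n m) _ (fun p => Psym p n m) (P1 n m)).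
have P2 m p : has_preadjoint true (fun n => P m n p).
  refine (@eq_preadjoint _ _ _ (fun n => P' n m p) _ (fun n => esym (PP' m n p)) _).
  exact: (triple_extension_preadjoint1 pil1' pil2' pil3' K0 piK').
have Ple := triple_extension_le pil1 pil2 pil3 K0 piK : forall m n p,
  `|P m n p| <= _.
have Pev := triple_extension_evaluation pil1 pil2 pil3 K0 piK : forall x y z,
  P (evaluation x) (evaluation y) (evaluation z) = _.
(* Beyond this point P is any bounded symmetric triple product that extends pi and
   has a preadjoint in each variable. *)
clear P' PP'; clearbody P; clear P0.
split.
- by move=> n p; apply: (preadjoint_semilinear (P1 n p)).
- by move=> m n; apply: (preadjoint_semilinear (P3 m n)).
- exact: Psym.
- by move=> m p; apply: (preadjoint_semilinear (P2 m p)).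
- apply: (@trilinear_continuous _ _ P false true false _ _ _ K) => //.
  + by move=> n p; apply: (preadjoint_semilinear (P1 n p)).
  + by move=> m p; apply: (preadjoint_semilinear (P2 m p)).
  + by move=> m n; apply: (preadjoint_semilinear (P3 m n)).
- exact: (@jordan_extension _ _ pi).
Qed.
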